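(* Every two-sided ideal in a (not necessarily unital) $QB$-ring is itself a $QB$-ring.
   Context: Rings are associative and not necessarily unital. For a ring $S$ let $\widetilde S=S\oplus\mathbb Z$ be its canonical unitization. For $s,t\in S$ write $s\perp t$ if $s\widetilde S t=0$ and $t\widetilde S s=0$. An element $x\in S$ is quasi-adversible, $x\in S_q^\circ$, if there are $b,c\in S$ with $(x+b-xb)\perp(x+c-cx)$. $\operatorname{cl}^\circ(S_q^\circ)$ is the set of $a\in S$ such that whenever $xa-x-a+b=0$ for some $x,b\in S$, there is $y\in S$ with $a-yb\in S_q^\circ$. $S$ is a $QB$-ring if $\operatorname{cl}^\circ(S_q^\circ)=S$. For unital $S$ this is equivalent to the following: for all $a,b,x\in S$ with $xa+b=1$ there is $y\in S$ such that $u=a+yb$ is quasi-invertible, meaning that there are $c,d\in S$ with $(1-uc)S(1-du)=0=(1-du)S(1-uc)$. *)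

(* Defs.v *)
From HB Require Import structures.
From mathcomp Require Import all_boot all_order all_algebra.
From mathcomp Require Import boolp classical_sets.

Set Implicit Arguments.
Unset Strict Implicit.
Unset Printing Implicit Defensive.

Import GRing.Theory.
Local Open Scope classical_set_scope.
Local Open Scope ring_scope.

Reserved Notation "x ** y" (at level 40, left associativity).

(* Associative, not necessarily unital rings; the MathComp hierarchy starts at
   rings that have a unit. *)
HB.mixin Record Zmodule_isRng R of GRing.Zmodule R := {
  rmul : R -> R -> R;
  rmulA : associative rmul;
  rmulDl : left_distributive rmul +%R;
  rmulDr : right_distributive rmul +%R
}.

#[short(type="rngType")]
HB.structure Definition Rng := { R of Zmodule_isRng R & GRing.Zmodule R }.

Notation "x ** y" := (rmul x y) : ring_scope.

Section RngTheory.
Variable S : rngType.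
Implicit Types x y z : S.

Lemma rmul0r x : 0 ** x = 0.
Proof. by apply: (addrI (0 ** x)); rewrite -rmulDl !addr0. Qed.

Lemma rmulr0 x : x ** 0 = 0.
Proof. by apply: (addrI (x ** 0)); rewrite -rmulDr !addr0. Qed.

Lemma rmulNr x y : (- x) ** y = - (x ** y).
Proof. by apply: (addrI (x ** y)); rewrite -rmulDl !subrr rmul0r. Qed.

Lemma rmulrN x y : x ** (- y) = - (x ** y).
Proof. by apply: (addrI (x ** y)); rewrite -rmulDr !subrr rmulr0. Qed.

Lemma rmulMnl x y n : (x *+ n) ** y = (x ** y) *+ n.
Proof. by elim: n => [|n IH]; rewrite ?mulr0n ?rmul0r // !mulrS rmulDl IH. Qed.

Lemma rmulMnr x y n : x ** (y *+ n) = (x ** y) *+ n.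
Proof. by elim: n => [|n IH]; rewrite ?mulr0n ?rmulr0 // !mulrS rmulDr IH. Qed.

Lemma rmulMzl x y (n : int) : (x *~ n) ** y = (x ** y) *~ n.
Proof.
by case: n => n; rewrite ?NegzE ?mulrNz ?rmulNr -!pmulrn rmulMnl.
Qed.

Lemma rmulMzr x y (n : int) : x ** (y *~ n) = (x ** y) *~ n.
Proof.
by case: n => n; rewrite ?NegzE ?mulrNz ?rmulrN -!pmulrn rmulMnr.
Qed.

End RngTheory.

Definition unitization (S : rngType) : Type := (S * int)%type.

HB.instance Definition _ (S : rngType) :=
  GRing.Zmodule.copy (unitization S) (S * int)%type.

Section Unitization.
Variable S : rngType.
Implicit Types u v w : unitization S.

Definition unitization_one : unitization S := (0, 1).

(* (s + m) (t + n) = (s t + n s + m t) + m n *)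
Definition unitization_mul u v : unitization S :=
  (u.1 ** v.1 + u.1 *~ v.2 + v.1 *~ u.2, u.2 * v.2).

Fact unitization_mulA : associative unitization_mul.
Proof.
move=> [x m] [y n] [z p]; rewrite /unitization_mul /=; congr pair; last first.
  by rewrite mulrA.
rewrite !rmulDl !rmulDr !rmulMzl !rmulMzr !mulrzDl rmulA -!mulrzA.
rewrite [n * m]mulrC [p * m]mulrC -!addrA; congr (_ + _).
by rewrite [X in _ = _ + X]addrCA [RHS]addrCA [X in _ = _ + (_ + X)]addrCA.
Qed.

Fact unitization_mul1l : left_id unitization_one unitization_mul.
Proof.
by case=> x m; rewrite /unitization_mul /= rmul0r mul0rz !add0r mulr1z mul1r.
Qed.

Fact unitization_mul1r : right_id unitization_one unitization_mul.
Proof.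
by case=> x m; rewrite /unitization_mul /= rmulr0 mul0rz addr0 add0r mulr1z mulr1.
Qed.

Fact unitization_mulDl : left_distributive unitization_mul +%R.
Proof.
move=> [x m] [y n] [z p]; rewrite /unitization_mul /=.
apply: (congr2 pair); last by rewrite mulrDl.
by rewrite rmulDl mulrzDl mulrzDr [RHS]addrACA [X in _ = X + _]addrACA.
Qed.

Fact unitization_mulDr : right_distributive unitization_mul +%R.
Proof.
move=> [x m] [y n] [z p]; rewrite /unitization_mul /=.
apply: (congr2 pair); last by rewrite mulrDr.
by rewrite rmulDr mulrzDl mulrzDr [RHS]addrACA [X in _ = X + _]addrACA.
Qed.

Fact unitization_oner_neq0 : unitization_one != 0.
Proof. by apply/eqP => -[]. Qed.

HB.instance Definition _ := GRing.Zmodule_isNzRing.Build (unitization S)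
  unitization_mulA unitization_mul1l unitization_mul1r
  unitization_mulDl unitization_mulDr unitization_oner_neq0.

Definition to_unitization (s : S) : unitization S := (s, 0).

End Unitization.

Section QBRing.
Variable S : rngType.
Implicit Types (s t a b c x y : S) (A : set S).

Definition rng_perp s t : Prop :=
  (forall r : unitization S, to_unitization s * r * to_unitization t = 0) /\
  (forall r : unitization S, to_unitization t * r * to_unitization s = 0).

Definition quasi_adversible : set S :=
  [set x | exists b c, rng_perp (x + b - x ** b) (x + c - c ** x)].

Definition adv_closure A : set S :=
  [set a | forall x b, x ** a - x - a + b = 0 -> exists y, A (a - y ** b)].

Definition QB_ring : Prop := adv_closure quasi_adversible = [set: S].

End QBRing.

Arguments QB_ring S : clear implicits.

Section Ideal.
Variables (S : rngType) (I : set S).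

Record two_sided_ideal : Prop := TwoSidedIdeal {
  ideal0 : I 0;
  idealB : forall x y, I x -> I y -> I (x - y);
  idealMl : forall s x, I x -> I (s ** x);
  idealMr : forall x s, I x -> I (x ** s)
}.

Hypothesis idealI : two_sided_ideal.

(* The unused proof argument is the key from which the ring structure on the
   subtype is inferred. *)
Definition ideal_pred of two_sided_ideal : {pred S} := fun x => x \in I.

Fact ideal_pred_zmod_closed : zmod_closed (ideal_pred idealI).
Proof.
split=> [|x y]; rewrite !unfold_in; first exact/mem_set/ideal0.
by move=> /set_mem Ix /set_mem Iy; apply/mem_set/idealB.
Qed.

HB.instance Definition _ :=
  GRing.isZmodClosed.Build S (ideal_pred idealI) ideal_pred_zmod_closed.

Record ideal_rng (hI : two_sided_ideal) : Type := IdealRng {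
  ideal_val :> S;
  ideal_valP : ideal_pred hI ideal_val
}.

HB.instance Definition _ := [isSub for @ideal_val idealI].
HB.instance Definition _ := [Choice of ideal_rng idealI by <:].
HB.instance Definition _ := [SubChoice_isSubZmodule of ideal_rng idealI by <:].

Fact ideal_mul_subproof (x y : ideal_rng idealI) :
  ideal_pred idealI (val x ** val y).
Proof. exact/mem_set/idealMl/set_mem/(ideal_valP y). Qed.

Definition ideal_mul (x y : ideal_rng idealI) : ideal_rng idealI :=
  IdealRng (ideal_mul_subproof x y).

Fact ideal_mulA : associative ideal_mul.
Proof. by move=> x y z; apply: val_inj; rewrite /= rmulA. Qed.

Fact ideal_mulDl : left_distributive ideal_mul +%R.
Proof. by move=> x y z; apply: val_inj; rewrite /= rmulDl. Qed.

Fact ideal_mulDr : right_distributive ideal_mul +%R.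
Proof. by move=> x y z; apply: val_inj; rewrite /= rmulDr. Qed.

HB.instance Definition _ := Zmodule_isRng.Build (ideal_rng idealI)
  ideal_mulA ideal_mulDl ideal_mulDr.

End Ideal.

(* Main.v *)
Require Import Defs.
From mathcomp Require Import all_boot all_order all_algebra.
From mathcomp Require Import boolp classical_sets.

(** If [X A + b = 1] then also [(X + b X) A + b^2 = 1], so the QB-property of
    [S] yields [y] with [u = A + y b^2] quasi-invertible; as [b] lies in [I],
    the coefficient [y b] lies in [I].  A quasi-invertible [u] has a
    quasi-inverse [v] with [u v u = u], and if [u] is in [1 + I] then this
    equation forces [v] to be in [1 + I] as well, so [u] is quasi-invertible
    relative to [I]. *)

Set Implicit Arguments.
Unset Strict Implicit.
Unset Printing Implicit Defensive.

Import GRing.Theory.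
Local Open Scope classical_set_scope.
Local Open Scope ring_scope.

(** The element [p + q - p * u * q] merges two one-sided quasi-inverses of [u] into a single one. *)
Lemma one_sub_mul_quasi_inverse (R : pzRingType) (u p q : R) :
  1 - u * (p + q - p * u * q) = (1 - u * p) * (1 - u * q).
Proof.
rewrite mulrBr mulrDr [RHS]mulrBl mul1r [u * p * _]mulrBr mulr1 !mulrA.
by rewrite -[RHS]addrA -opprD addrA [u * q + _]addrC.
Qed.

Lemma one_sub_quasi_inverse_mul (R : pzRingType) (u p q : R) :
  1 - (p + q - p * u * q) * u = (1 - p * u) * (1 - q * u).
Proof.
by rewrite [p + q]addrC -mulrA; apply: (@one_sub_mul_quasi_inverse R^c u q p).
Qed.

(** With [v] the merged element, [u - u v u = (1 - u p) (1 - u q) u], and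
    [(1 - u q) u = u (1 - q u)]. *)
Lemma quasi_inverse_regular (R : pzRingType) (u p q : R) :
  (1 - u * p) * u * (1 - q * u) = 0 ->
  u * (p + q - p * u * q) * u = u.
Proof.
move=> puq0; apply/esym/eqP; rewrite -subr_eq0 -[X in X - _]mul1r -mulrBl.
rewrite one_sub_mul_quasi_inverse -puq0 -!mulrA; apply/eqP; congr (_ * _).
by rewrite mulrBl mulrBr mul1r mulr1 mulrA.
Qed.

Section Circle.
Variable S : rngType.
Implicit Types a b c d x y : S.

(** The product of the unitization, transported along [x] to [1 - x]. *)
Definition circle x y : S := x + y - x ** y.

Notation iota := (@to_unitization S).

Lemma to_unitizationD x y : iota (x + y) = iota x + iota y.
Proof. by []. Qed.

Lemma to_unitizationN x : iota (- x) = - iota x.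
Proof. by []. Qed.

Lemma to_unitizationM x y : iota (x ** y) = iota x * iota y.
Proof. by apply: (congr2 pair); rewrite /= ?mulr0z ?addr0. Qed.

Lemma to_unitization_inj : injective iota.
Proof. by move=> x y []. Qed.

Definition to_unitizationE :=
  (to_unitizationD, to_unitizationN, to_unitizationM).

Lemma to_unitization_circle x y :
  iota (circle x y) = 1 - (1 - iota x) * (1 - iota y).
Proof.
rewrite /circle !to_unitizationE mulrBr mulr1 mulrBl mul1r.
by rewrite !opprB -!addrA [RHS]addrC !addrA subrK -addrA addrC.
Qed.

Lemma one_sub_circle x y : 1 - iota (circle x y) = (1 - iota x) * (1 - iota y).
Proof. by rewrite to_unitization_circle opprB addrC subrK. Qed.

Lemma quasi_adversible_regular x : quasi_adversible x ->
  exists v, rng_perp (circle x v) (circle v x) /\ circle (circle x v) x = x.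
Proof.
case=> c [d []]; rewrite -/(circle x c) [x + d]addrC -/(circle d x) => cd dc.
pose u := 1 - iota x; pose p := 1 - iota c; pose q := 1 - iota d.
(* In the unitization [1 - w = p u q], so that [1 - v] is the merged element [p + q - p u q]. *)
pose w := circle (circle c x) d; exists (c + d - w); set v := c + d - w.
have vE : 1 - iota v = p + q - p * u * q.
  rewrite -!one_sub_circle -/w !to_unitizationE !opprD !opprK !addrA.
  by rewrite [_ + 1 - _]addrAC addrK.
have eqc r : (1 - u * p) * r * (1 - q * u) = 0.
  by rewrite -(cd r) !to_unitization_circle.
have eqd r : (1 - q * u) * r * (1 - u * p) = 0.
  by rewrite -(dc r) !to_unitization_circle.
split.
  split=> r; rewrite !to_unitization_circle vE -/u.
    (* In this order the outer factors [1 - u p] and [1 - q u] annihilate all that lies between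
       them; in the reverse order the inner factors do. *)
    rewrite one_sub_mul_quasi_inverse one_sub_quasi_inverse_mul.
    by rewrite -(eqc ((1 - u * q) * r * (1 - p * u))) !mulrA.
  rewrite one_sub_mul_quasi_inverse one_sub_quasi_inverse_mul.
  rewrite -[RHS](mul0r (1 - u * q)) -(mulr0 (1 - p * u)) -(eqd r).
  by rewrite !mulrA.
apply/to_unitization_inj/oppr_inj/(addrI 1).
by rewrite !one_sub_circle vE quasi_inverse_regular.
Qed.

(* Multiply [(1 - x) (1 - a) + b = 1] on the left by [1 + b] and expand; the
   coefficient [(1 + b) (1 - x)] is [1 - (x + (b x - b))]. *)
Lemma square_relation a x b : x ** a - x - a + b = 0 ->
  (x + (b ** x - b)) ** a - (x + (b ** x - b)) - a + b ** b = 0.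
Proof.
move=> /eqP; rewrite addr_eq0 => /eqP xab.
have eE : (b ** x - b) ** a - (b ** x - b) = b - b ** b.
  rewrite rmulDl rmulNr -rmulA opprB addrA addrAC [_ - _ - _]addrAC.
  have := congr1 (rmul b) xab; rewrite !rmulDr !rmulrN => ->; exact: addrC.
rewrite rmulDl opprD addrACA [_ + _ - a]addrAC.
by rewrite xab eE addrA addNr add0r addNr.
Qed.

End Circle.

Section Ideal.
Variables (S : rngType) (I : set S) (hI : two_sided_ideal I).
Implicit Types x y : ideal_rng hI.

Lemma ideal_rngP (s : S) : I s -> exists x : ideal_rng hI, val x = s.
Proof. by move=> Is; exists (IdealRng (mem_set Is : ideal_pred hI s)). Qed.

Lemma ideal_valI x : I (val x).
Proof. exact: set_mem (ideal_valP x). Qed.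

(** The unitization of [I] embeds multiplicatively into that of [S], where the products vanish. *)
Lemma ideal_rng_perp x y : rng_perp (val x) (val y) -> rng_perp x y.
Proof.
pose phi (r : unitization (ideal_rng hI)) : unitization S := (val r.1, r.2).
have phi_inj : injective phi by move=> [? ?] [? ?] [] /val_inj -> ->.
have phiM r s : phi (r * s) = phi r * phi s.
  by apply: (congr2 pair) => //=; rewrite -!(raddfMz val).
case=> xy yx; split=> r; apply: phi_inj; rewrite !phiM.
  exact: xy (phi r).
exact: yx (phi r).
Qed.

Lemma quasi_adversible_ideal x : quasi_adversible (val x) -> quasi_adversible x.
Proof.
case/quasi_adversible_regular=> v [xv vE].
have Ix := ideal_valI x.
(* Each side gives [val x] when added to [circle (val x) v]. Solving for [v] then exhibits it as a
   difference of elements of [I]. *)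
have wx : val x - circle (val x) v ** val x = val x ** v - v.
  apply: (addrI (circle (val x) v)); rewrite addrA [LHS]vE /circle.
  by rewrite addrA subrK addrK.
have Iv : I v.
  rewrite -(subKr (val x ** v) v) -wx; apply: (idealB hI).
    exact: (Defs.idealMr hI v Ix).
  exact: (idealB hI Ix (idealMl hI _ Ix)).
have [c cE] := ideal_rngP Iv; exists c, c; rewrite -cE in xv.
by rewrite [X in rng_perp _ (X - _)]addrC; apply: ideal_rng_perp.
Qed.

End Ideal.

Theorem corollary4p10 (S : rngType) (I : set S) (hI : two_sided_ideal I) :
  QB_ring S -> QB_ring (ideal_rng hI).
Proof.
move=> QBS; apply/seteqP; split=> // a _ x b xab.
have aS : adv_closure (@quasi_adversible S) (val a) by rewrite QBS.
have [y ay] := aS _ _ (square_relation (congr1 val xab)).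
(* The square leaves a spare factor: [y ** (b ** b) = (y ** b) ** b], where [y] is only known to lie
   in [S]. *)
have [c cE] := ideal_rngP hI (idealMl hI y (ideal_valI b)).
exists c; apply: quasi_adversible_ideal.
by move: ay; rewrite rmulA -cE.
Qed.
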